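(* Let $\Gamma=(P,\mathcal{L})$ be a point-line geometry satisfying the Exchange Property (EP). Suppose that the rank $\mathrm{rk}(\Gamma)$ is infinite and that $2^{\mathfrak{n}}\leq \mathrm{rk}(\Gamma)$ for every cardinal number $\mathfrak{n}<\mathrm{rk}(\Gamma)$. Then $$\mathrm{rk}_{\mathrm{C}}(\Gamma)\ \geq\ 2^{\mathrm{rk}(\Gamma)}\ >\ \mathrm{rk}(\Gamma).$$
   Context: A point-line geometry is a pair $\Gamma=(P,\mathcal{L})$ where $P$ (points) is a non-empty set and $\mathcal{L}$ (lines) is a family of subsets of $P$, each containing at least two points. A subspace of $\Gamma$ is a subset $S\subseteq P$ such that every line meeting $S$ in at least two points is contained in $S$ (so $\emptyset$ and $P$ are subspaces). For $X\subseteq P$, $\langle X\rangle$ is the smallest subspace containing $X$. Exchange Property (EP): for all $X\subseteq P$ and $x,y\in P$, if $y\in\langle X\cup\{x\}\rangle$ but $y\notin\langle X\rangle$, then $x\in\langle X\cup\{y\}\rangle$. The generating rank is $\mathrm{rk}_{\mathrm{gen}}(\Gamma):=\min\{|X| : X\subseteq P,\ \langle X\rangle=P\}$. When (EP) holds, it is called the rank of $\Gamma$ and denoted $\mathrm{rk}(\Gamma)$; in this case it equals the cardinality of any minimal generating set. A chain of subspaces is a (non-empty) set $\mathcal{C}$ of subspaces totally ordered by inclusion; its length is $\ell(\mathcal{C}):=|\mathcal{C}|-1$, with $|\mathcal{C}|-1=|\mathcal{C}|$ if $|\mathcal{C}|$ is infinite. $\mathfrak{C}(\Gamma)$ is the family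 of all chains of subspaces of $\Gamma$, and $\mathrm{rk}_{\mathrm{C}}(\Gamma):=\sup\{\ell(\mathcal{C}) : \mathcal{C}\in\mathfrak{C}(\Gamma)\}$ (supremum of cardinals). *)

(* Defs.v *)
From mathcomp Require Import all_boot finmap.
From mathcomp Require Import boolp classical_sets functions cardinality.

Set Implicit Arguments.
Unset Strict Implicit.
Unset Printing Implicit Defensive.

Local Open Scope classical_set_scope.
Local Open Scope card_scope.

(* A cardinal number is an equipotence class of types.  The library compares
   cardinals only through the relations [#<=] and [#=] on sets; with a type of
   cardinals, minima, suprema and exponentials are operations.  This type is
   larger than the types it measures, so collections of cardinals are plain
   predicates [cardinal -> Prop]: using [set cardinal] or giving [cardinal] a
   [choiceType] structure would make [card (C : set (set T))] a universe
   inconsistency. *)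
Record cardinal := Cardinal {
  cclass : Type -> Prop;
  cclassP : exists A : Type, cclass = (fun B : Type => [set: A] #= [set: B])
}.

Definition cardT (A : Type) : cardinal :=
  @Cardinal (fun B : Type => [set: A] #= [set: B]) (ex_intro _ A erefl).

Definition crepr (k : cardinal) : Type := projT1 (cid (cclassP k)).

Definition card T (A : set T) : cardinal := cardT A.

Definition cnat (n : nat) : cardinal := cardT 'I_n.

Definition cle (k l : cardinal) : Prop := [set: crepr k] #<= [set: crepr l].
Definition clt (k l : cardinal) : Prop := cle k l /\ k <> l.

Definition cexp (k l : cardinal) : cardinal := cardT (crepr l -> crepr k).

Declare Scope cardinal_scope.
Delimit Scope cardinal_scope with cardinal.
Bind Scope cardinal_scope with cardinal.
Notation "k <= l" := (cle k l) : cardinal_scope.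
Notation "k < l" := (clt k l) : cardinal_scope.
Notation "k ^ l" := (cexp k l) : cardinal_scope.

Definition cfinite (k : cardinal) : Prop := exists n, k = cnat n.

Section MinSup.
Local Open Scope cardinal_scope.
Implicit Types (S : cardinal -> Prop) (k l : cardinal).

Definition is_cmin S k : Prop := S k /\ forall l, S l -> k <= l.

Definition cubound S k : Prop := forall l, S l -> l <= k.

(* The default value is returned only when S is empty, see [cminP]; hence [csup]
   is the least upper bound of any S that is bounded above, see [csupP]. *)
Definition cmin S : cardinal :=
  if pselect (exists k, is_cmin S k) is left h then projT1 (cid h) else cnat 0.

Definition csup S : cardinal := cmin (cubound S).

End MinSup.

Section CardinalTheory.
Local Open Scope cardinal_scope.
Implicit Types (S : cardinal -> Prop) (k l m : cardinal).

Lemma cardT_eq A B : (cardT A = cardT B) <-> ([set: A] #= [set: B]).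
Proof.
split=> [[e]|AB].
  have /= := congr1 (fun c : Type -> Prop => c B) e.
  by rewrite card_eqxx => ->.
have e : (fun C : Type => [set: A] #= [set: C] : Prop) =
         (fun C : Type => [set: B] #= [set: C] : Prop).
  apply: funext => C; apply: propext; split=> h.
    by apply: card_eq_trans h; rewrite card_eq_sym.
  exact: card_eq_trans AB h.
rewrite /cardT; move: (ex_intro _ A _) (ex_intro _ B _).
by rewrite e => p q; congr Cardinal; exact: Prop_irrelevance.
Qed.

Lemma creprK k : cardT (crepr k) = k.
Proof.
rewrite /crepr; case: cid => A; case: k => c p /= e.
by rewrite /cardT; move: (ex_intro _ A _); rewrite -e => q;
  congr Cardinal; exact: Prop_irrelevance.
Qed.

Lemma crepr_eq A : [set: crepr (cardT A)] #= [set: A].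
Proof. by apply/cardT_eq; rewrite creprK. Qed.

Lemma card_leT_inj A B :
  ([set: A] #<= [set: B]) <-> exists f : A -> B, injective f.
Proof.
split=> [/card_leP[f]|[f fI]].
  exists (fun a => val (f (SigSub (mem_set (I : [set: A] a))))) => a b.
  by move=> /val_inj /(inj (mem_set I) (mem_set I)) [].
have [g] : $|{injfun [set: A] >-> [set: B]}|.
  by apply/injfunPex; exists f => // x y _ _; exact: fI.
exact: inj_card_le g.
Qed.

Lemma cle_cardT A B : (cardT A <= cardT B) <-> exists f : A -> B, injective f.
Proof.
rewrite -card_leT_inj /cle.
by rewrite (card_le_eql (crepr_eq A)) (card_le_eqr (crepr_eq B)).
Qed.

Lemma cle_card T U (A : set T) (B : set U) : (card A <= card B) <-> (A #<= B).
Proof.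
rewrite cle_cardT; split=> [[f fI]|/card_leP[f]]; last first.
  by exists f => a b; apply: inj; rewrite inE.
by apply/card_leP/injfunPex; exists f => // x y _ _; exact: fI.
Qed.

Lemma card_setT A : card [set: A] = cardT A.
Proof.
apply/cardT_eq; apply/card_bijP.
have [f /= fb] : exists f : [set: A] -> A, bijective f.
  by exists val; exists (fun a => SigSub (mem_set (I : [set: A] a))) => [[a p]|//];
    exact: val_inj.
exists (fun x => SigSub (mem_set (I : [set: A] (f (val x))))).
case: fb => g fK gK.
exists (fun x => SigSub (mem_set (I : [set: [set: A]] (g (val x))))) => x;
  by apply: val_inj; rewrite /= ?fK ?gK.
Qed.

Lemma cle_refl k : k <= k.
Proof. exact: card_lexx. Qed.

Lemma cle_trans l k m : k <= l -> l <= m -> k <= m.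
Proof. exact: card_le_trans. Qed.

Lemma cle_anti k l : k <= l -> l <= k -> k = l.
Proof.
move=> kl lk; rewrite -(creprK k) -(creprK l); apply/cardT_eq.
exact: Cantor_Bernstein kl lk.
Qed.

Lemma cnatE n : cnat n = card `I_n.
Proof.
apply: cle_anti; apply/cle_cardT.
  exists (fun i : 'I_n => SigSub (mem_set (ltn_ord i : `I_n i))) => i j [].
  exact: val_inj.
exists (fun a : `I_n => Ordinal (set_mem (valP a))) => a b [ab].
exact: val_inj.
Qed.

Lemma family_min I (A : I -> Type) : I ->
  exists i, forall j, exists f : A i -> A j, injective f.
Proof.
move=> i0; pose T := forall i, A i.
pose P (F : set T) := forall x y, F x -> F y -> forall i, x i = y i -> x = y.
have [|F [PF maxF]] := @Zorn_bigcup T P.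
  move=> C CP totC x y [X CX Xx] [Y CY Yy] i xy.
  by have [XY|YX] := totC _ _ CX CY;
    [apply: (CP _ CY) xy => //; exact: XY|apply: (CP _ CX) xy => //; exact: YX].
have [[i surjF]|nsurj] :=
    pselect (exists i, forall a : A i, exists2 x : T, F x & x i = a).
  have /choice[g gP] a : exists x : T, F x /\ x i = a.
    by have [x] := surjF a; exists x.
  exists i => j; exists (fun a => g a j) => a b gab.
  have gabE : g a = g b by apply: PF gab; apply: (gP _).1.
  by rewrite -(gP a).2 gabE (gP b).2.
have miss i : {a : A i | forall x, F x -> x i <> a}.
  apply: cid; apply: contrapT => h; apply: nsurj; exists i => a.
  apply: contrapT => h'; apply: h; exists a => x Fx xa.
  by apply: h'; exists x.
pose c : T := fun i => projT1 (miss i).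
have cP x i : F x -> x i <> c i by exact: (projT2 (miss i)).
exfalso; apply: (maxF (c |` F)).
  split; first by move=> x Fx; right.
  by move=> /(_ c (or_introl erefl)) /(cP _ i0).
move=> x y [->|Fx] [->|Fy] i xy //.
- by case: (cP _ i Fy).
- by case: (cP _ i Fx).
- exact: PF xy.
Qed.

Lemma cle_total k l : k <= l \/ l <= k.
Proof.
have [b bP] := family_min (fun b : bool => crepr (if b then k else l)) true.
rewrite /cle; case: b bP => bP; [left|right]; apply/card_leT_inj.
  exact: bP false.
exact: bP true.
Qed.

Lemma cminP S : (exists k, S k) -> is_cmin S (cmin S).
Proof.
move=> [k0 Sk0]; suff ex : exists k, is_cmin S k.
  by rewrite /cmin; case: pselect => // h; case: cid.
pose I := {X : crepr k0 -> Prop | S (cardT {a | X a})}.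
have subrepr l : l <= k0 -> exists X : crepr k0 -> Prop, cardT {a | X a} = l.
  move=> /card_leT_inj[f fI]; exists (fun a => exists b, f b = a).
  rewrite -[RHS](creprK l); apply: cle_anti; apply/cle_cardT; last first.
    exists (fun b => exist _ (f b) (ex_intro _ b erefl)) => a b [].
    exact: fI.
  exists (fun a : {a | exists b, f b = a} => projT1 (cid (proj2_sig a))) => -[a pa] [b pb] /=.
  case: cid => x /= xa; case: cid => y /= yb xy; subst x; subst a; subst b.
  by congr exist; exact: Prop_irrelevance.
have [X0 X0k] := subrepr _ (cle_refl k0).
have i0 : I by exists X0; rewrite X0k.
have [[X SX] Xmin] := family_min (fun i : I => {a | sval i a}) i0.
exists (cardT {a | X a}); split=> // l Sl.
have leX (Y : crepr k0 -> Prop) (SY : S (cardT {a | Y a})) : cardT {a | X a} <= cardT {a | Y a}.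
  by apply/cle_cardT; exact: (Xmin (exist _ Y SY)).
have [/subrepr[Y Yl]|k0l] := cle_total l k0.
  by rewrite -Yl; apply: leX; rewrite Yl.
by apply: cle_trans k0l; have := leX X0; rewrite X0k; exact.
Qed.

Lemma csupP S : (exists k, cubound S k) ->
  cubound S (csup S) /\ forall k, cubound S k -> csup S <= k.
Proof. exact: cminP. Qed.

End CardinalTheory.

Record plgeometry := PLGeometry {
  pt : Type;
  lines : set (set pt);
  pt_nonempty : [set: pt] !=set0;
  lines_two : forall L, lines L -> exists x y, [/\ x <> y, L x & L y]
}.

Section Geometry.
Variable G : plgeometry.
Local Notation P := (pt G).
Implicit Types (S X : set P) (C : set (set P)).

Definition subspace S : Prop :=
  forall L, lines L ->
    (exists x y, [/\ x <> y, (L `&` S) x & (L `&` S) y]) -> L `<=` S.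

Definition spn X : set P := smallest subspace X.

Definition exchange_property : Prop :=
  forall X (x y : P), spn (X `|` [set x]) y -> ~ spn X y ->
    spn (X `|` [set y]) x.

Definition generating X : Prop := spn X = [set: P].

Definition gen_rank : cardinal :=
  cmin (fun k => exists2 X, generating X & k = card X).

(* The generating rank is called rank only under the exchange property. *)
Definition rank (EP : exchange_property) : cardinal := gen_rank.

Definition is_chain C : Prop :=
  [/\ C !=set0, C `<=` subspace & total_on C subset].

(* |C| - 1, read as |C| when C is infinite. *)
Definition chain_length C : cardinal :=
  if `[< finite_set C >] then cnat #|` fset_set C|.-1 else card C.

Definition chain_rank : cardinal :=
  csup (fun k => exists2 C, is_chain C & k = chain_length C).

Lemma subspaceT : subspace [set: P].
Proof. by []. Qed.

Lemma spn_subspace X : subspace (spn X).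
Proof.
move=> L GL [x [y [xy [Lx Sx] [Ly Sy]]]] z Lz M [sM XM].
apply: (sM L GL _ z Lz); exists x, y.
by split=> //; split=> //; [apply: Sx|apply: Sy].
Qed.

Lemma gen_rankP :
  (exists2 X, generating X & gen_rank = card X) /\
  (forall X, generating X -> cle gen_rank (card X)).
Proof.
have [|h1 h2] := @cminP (fun k => exists2 X, generating X & k = card X).
  exists (card [set: P]), [set: P] => //.
  by apply/seteqP; split=> // x _ M [_ TM]; exact: TM.
by split=> // X gX; apply: h2; exists X.
Qed.

Lemma chain_length_le C : cle (chain_length C) (card C).
Proof.
rewrite /chain_length; case: asboolP => [[n Cn]|_]; last exact: cle_refl.
rewrite (card_fset_set Cn) cnatE cle_card (card_le_eqr Cn) card_le_II.
exact: leq_pred.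
Qed.

Lemma chain_rankP :
  (forall C, is_chain C -> cle (chain_length C) chain_rank) /\
  (forall k, (forall C, is_chain C -> cle (chain_length C) k) ->
     cle chain_rank k).
Proof.
have [|h1 h2] := @csupP (fun k => exists2 C, is_chain C & k = chain_length C).
  exists (card [set: set P]) => _ [C _ ->].
  apply: cle_trans (chain_length_le C) _; apply/cle_card.
  exact: card_leT.
split=> [C chC|k hk]; first by apply: h1; exists C.
by apply: h2 => _ [C chC ->]; exact: hk.
Qed.

End Geometry.

(* Main.v *)
(* Let k be the rank. By (EP) and Zorn there is an independent generating set B of
   size k, and on subsets of B the span is an order embedding, so it is enough to
   find a chain of 2^k subsets of a set of size k. Order the 0-1 sequences indexed
   by the initial ordinal of k lexicographically. The sequences with a last 1 are
   determined by the place of that 1 and by a sequence on a proper initial segment;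
   since 2^n <= k for n < k, there are at most k * k = k of them. They separate any
   two sequences, so sending a sequence to the set of those below it gives the
   chain. *)
From mathcomp Require Import all_boot.
From mathcomp Require Import boolp classical_sets functions cardinality wochoice.
Require Import Defs.

Set Implicit Arguments.
Unset Strict Implicit.
Unset Printing Implicit Defensive.

Local Open Scope classical_set_scope.

(** * Squares, well-orders and powers of cardinals *)

Lemma card_le_funP T U (u0 : U) (A : set T) (B : set U) :
  cle (card A) (card B) ->
  exists f : T -> U, (forall x, A x -> B (f x)) /\
    (forall x y, A x -> A y -> f x = f y -> x = y).
Proof.
move=> /cle_cardT[f fI].
exists (fun x => if pselect (A x) is left h then val (f (SigSub (mem_set h))) else u0).
split=> [x Ax|x y Ax Ay]; case: pselect => //= h.
  by case: (f _) => z /= /set_mem.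
by case: pselect => //= h' /val_inj /fI [].
Qed.

(** Zorn's lemma on the sets closed under an injective pairing, ordered by extension. If the
    complement of a maximal such set [A] embeds in [A], then so does all of [T], and the pairing of
    [A] is pulled back; otherwise [A] has a copy outside itself, to which the pairing extends. *)
Lemma infinite_square T : (exists f : nat -> T, injective f) ->
  exists p : T * T -> T, injective p.
Proof.
move=> [e eI].
pose a0 := e 0; pose a1 := e 1.
have a01 : a0 <> a1 by move/eI.
pose good (q : set T * (T * T -> T)) := [/\ q.1 a0, q.1 a1,
  (forall x y, q.1 x -> q.1 y -> q.1 (q.2 (x, y))) &
  (forall x y z t, q.1 x -> q.1 y -> q.1 z -> q.1 t ->
     q.2 (x, y) = q.2 (z, t) -> x = z /\ y = t)].
pose N := {q | good q}.
pose le (q r : N) := (sval q).1 `<=` (sval r).1 /\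
  forall x y, (sval q).1 x -> (sval q).1 y -> (sval q).2 (x, y) = (sval r).2 (x, y).
have [k kK] : exists k, cancel e k.
  have /choice[k kP] x : exists n, forall m, e m = x -> m = n.
    have [[n <-]|ne] := pselect (exists n, e n = x); first by exists n => m /eI.
    by exists 0 => m me; case: ne; exists m.
  by exists k => n; exact/esym/kP.
have g0 : good (range e, fun xy => e (choice.pickle (k xy.1, k xy.2))).
  split; [by exists 0|by exists 1|by move=> *; eexists|].
  move=> _ _ _ _ [x _ <-] [y _ <-] [z _ <-] [t _ <-] /= /eI.
  by move/(pcan_inj choice.pickleK); rewrite !kK => -[-> ->].
have [||A totA|[[A p] [/= A0 A1 pA pI]] max] :=
    @ZL_preorder N (exist _ _ g0) (fun q r => `[< le q r >]).
- by move=> q; apply/asboolP; split.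
- move=> r q s /asboolP[rq rqE] /asboolP[qs qsE]; apply/asboolP.
  split=> [x /rq/qs//|x y rx ry]; rewrite rqE// qsE//; exact: rq.
- have [[q0 Aq0]|nA] := pselect (exists q, A q); last first.
    by exists (exist _ _ g0) => q Aq; case: nA; exists q.
  have tot q r : A q -> A r -> le q r \/ le r q.
    by move=> Aq Ar; have [/asboolP|/asboolP] := totA _ _ Aq Ar; [left|right].
  pose D := \bigcup_(q in A) (sval q).1.
  have /choice[f fP] xy : exists z, forall q, A q -> (sval q).1 xy.1 ->
      (sval q).1 xy.2 -> z = (sval q).2 xy.
    case: xy => x y /=.
    have [[q [Aq qx qy]]|nq] :=
      pselect (exists q, [/\ A q, (sval q).1 x & (sval q).1 y]); last first.
      by exists x => q Aq qx qy; case: nq; exists q.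
    exists ((sval q).2 (x, y)) => r Ar rx ry.
    by have [[_ ->]|[_ ->]] := tot _ _ Ar Aq.
  have fE q x y : A q -> (sval q).1 x -> (sval q).1 y -> f (x, y) = (sval q).2 (x, y).
    by move=> Aq qx qy; exact: fP.
  have dir q r : A q -> A r -> exists s, [/\ A s, (sval q).1 `<=` (sval s).1 &
      (sval r).1 `<=` (sval s).1].
    by move=> Aq Ar; have [[h _]|[h _]] := tot _ _ Aq Ar; [exists r; split|exists q; split].
  have gf : good (D, f).
    split => /=.
    + by exists q0 => //; case: (proj2_sig q0).
    + by exists q0 => //; case: (proj2_sig q0).
    + move=> x y [q Aq qx] [r Ar ry]; have [s [As qs rs]] := dir _ _ Aq Ar.
      have [sx sy] : (sval s).1 x /\ (sval s).1 y by split; [exact: qs|exact: rs].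
      by rewrite (fE s)//; exists s => //; case: (proj2_sig s) => _ _ sA _; exact: sA.
    + move=> x y z t [q Aq qx] [r Ar ry] [u Au uz] [v Av vt].
      have [s [As qs rs]] := dir _ _ Aq Ar; have [s' [As' us vs]] := dir _ _ Au Av.
      have [w [Aw sw sw']] := dir _ _ As As'.
      have [wx wy wz wt] : [/\ (sval w).1 x, (sval w).1 y, (sval w).1 z & (sval w).1 t].
        by split; [apply/sw/qs|apply/sw/rs|apply/sw'/us|apply/sw'/vs].
      by rewrite !(fE w)//; case: (proj2_sig w) => _ _ _ wI; exact: wI.
  exists (exist _ _ gf) => q Aq; apply/asboolP; split=> /= [x qx|x y qx qy].
    by exists q.
  by rewrite (fE q).
(* On [A], the maps [p (_, a0)] and [p (_, a1)] are injections into [A] with disjoint images, which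
   makes room for a part of [A] together with a part that embeds in [A]. *)
have glue (B : set T) (h : T -> T) : (forall x, B x -> ~ A x -> A (h x)) ->
    (forall x y, B x -> B y -> ~ A x -> ~ A y -> h x = h y -> x = y) ->
    exists g : T -> T, (forall x, B x -> A (g x)) /\
      forall x y, B x -> B y -> g x = g y -> x = y.
  move=> hA hI.
  exists (fun x => if pselect (A x) then p (x, a0) else p (h x, a1)).
  split=> [x Bx|x y Bx By].
    by case: pselect => Ax; apply: (pA) => //; exact: hA.
  case: pselect => Ax.
    case: pselect => Ay E; first by have [] := pI _ _ _ _ Ax A0 Ay A0 E.
    by have [] := pI _ _ _ _ Ax A0 (hA _ By Ay) A1 E.
  case: pselect => Ay E.
    by have [_ /esym] := pI _ _ _ _ (hA _ Bx Ax) A1 Ay A0 E.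
  by have [/hI->] := pI _ _ _ _ (hA _ Bx Ax) A1 (hA _ By Ay) A1 E.
have [/(card_le_funP a0)[h [hA hI]]|/(card_le_funP a0)[j [jA jI]]] :=
    cle_total (card (~` A)) (card A).
  have [||g [gA gI]] := glue setT h.
  - by move=> x _; exact: hA.
  - by move=> x y _ _; exact: hI.
  exists (fun xy => p (g xy.1, g xy.2)) => -[x y] [z t] /=.
  have gA' u : A (g u) by exact: gA.
  by move=> /(pI _ _ _ _ (gA' x) (gA' y) (gA' z) (gA' t))[/gI-> // /gI->].
exfalso.
(* [j] sends [A] into its complement: pairs outside [A * A] are first moved into
   [A] by [g], then paired by [p], and the result is put in the fresh copy [j A]. *)
pose B := A `|` j @` A.
have /choice[i iP] x : exists y, forall y', A y' -> j y' = x -> y = y'.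
  have [[y Ay <-]|nx] := pselect (exists2 y, A y & j y = x).
    by exists y => y' Ay' /esym /jI; exact.
  by exists x => y' Ay' jy'; case: nx; exists y'.
have [||g [gA gI]] := glue B i.
- by move=> x [//|[y Ay yx]] _; rewrite (iP _ y).
- move=> x y [//|[x' Ax' xx']] [//|[y' Ay' yy']] _ _.
  by rewrite (iP _ x')// (iP _ y')// -xx' -yy' => ->.
pose q xy := if pselect (A xy.1 /\ A xy.2) then p xy else j (p (g xy.1, g xy.2)).
have gq : good (B, q).
  split; [by left|by left| |].
    move=> x y Bx By; rewrite /q/=; case: pselect => [[Ax Ay]|nA].
      by left; exact: (pA).
    by right; eexists => //; apply: (pA); exact: gA.
  move=> x y z t Bx By Bz Bt; rewrite /q/=.
  have Ag u v : B u -> B v -> A (p (g u, g v)) by move=> *; apply: (pA); exact: gA.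
  case: pselect => [[Ax Ay]|nxy]; case: pselect => [[Az At]|nzt].
  - exact: (pI).
  - by move=> /= E; case: (jA (p (g z, g t)) (Ag _ _ Bz Bt)); rewrite -E; exact: (pA).
  - by move=> /= E; case: (jA (p (g x, g y)) (Ag _ _ Bx By)); rewrite E; exact: (pA).
  - move=> /(jI _ _ (Ag _ _ Bx By) (Ag _ _ Bz Bt)).
    move=> /(pI _ _ _ _ (gA _ Bx) (gA _ By) (gA _ Bz) (gA _ Bt))[E1 E2].
    by split; exact: gI.
have /asboolP[/= BA _] : `[< le (exist _ _ gq) (exist _ (A, p) (And4 A0 A1 pA pI)) >].
  apply: (max (exist _ _ gq)); apply/asboolP; split=> /= [x Ax|x y Ax Ay]; first by left.
  by rewrite /q/=; case: pselect => // -[].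
by apply: (jA _ A0); apply: BA; right; exists a0.
Qed.

(* The order type of [lt] is the initial ordinal of [card T]. *)
Lemma initial_order T : exists lt : T -> T -> Prop, [/\
  forall x y z, lt x y -> lt y z -> lt x z,
  forall x y, [\/ lt x y, x = y | lt y x],
  forall A : set T, A !=set0 -> exists2 m, A m & forall x, lt x m -> ~ A x &
  forall a, clt (card [set x | lt x a]) (cardT T)].
Proof.
elim/Peq: T => T.
have [R woR] := well_ordering_principle T.
have minR (A : set T) : A !=set0 -> exists2 m, A m & forall x, A x -> R m x.
  move=> [x Ax]; have [|m [[/= mA mlb] _]] := woR [pred x | `[< A x >]].
    by exists x; apply/asboolP.
  exists m; first exact/asboolP.
  by move=> y Ay; apply: mlb; apply/asboolP.
have totR x y : R x y \/ R y x.
  have [|m [->|->] h] := minR [set x; y]; first by exists x; left.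
    by left; apply: h; right.
  by right; apply: h; left.
have antiR x y : R x y -> R y x -> x = y.
  move=> xy yx.
  (* The minimum given by [woR] is unique, and here both [x] and [y] are minima of the pair. *)
  have [|m [_ mu]] := woR [pred z | (z == x) || (z == y)].
    by exists x; rewrite inE eqxx.
  have RR z : R z z by have [] := totR z z.
  have mx : m = x.
    apply: mu; split; first by rewrite inE eqxx.
    by move=> z; rewrite inE => /orP[]/eqP->.
  rewrite -mx; apply: mu; split; first by rewrite inE eqxx orbT.
  by move=> z; rewrite inE => /orP[]/eqP->.
have transR x y z : R x y -> R y z -> R x z.
  move=> xy yz.
  have [|m [[->|->]|->] h] := minR [set x; y; z]; first by exists x; left; left.
  - by apply: h; right.
  - by have yx : R y x by [apply: h; left; left]; rewrite (antiR _ _ xy yx).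
  - by have zy : R z y by [apply: h; left; right]; rewrite -(antiR _ _ yz zy).
pose lt x y := R x y /\ x <> y.
have lt_trans x y z : lt x y -> lt y z -> lt x z.
  move=> [xy nxy] [yz nyz]; split; first exact: transR yz.
  by move=> xz; subst z; apply: nxy; exact: antiR.
have lt_tot x y : [\/ lt x y, x = y | lt y x].
  have [->|nxy] := pselect (x = y); first by constructor 2.
  have [xy|yx] := totR x y; first by constructor 1.
  by constructor 3; split => // yx'; exact: nxy.
have lt_min (A : set T) : A !=set0 -> exists2 m, A m & forall x, lt x m -> ~ A x.
  move=> /minR[m Am mlb]; exists m => // x [xm nxm] Ax.
  by apply: nxm; apply: antiR => //; exact: mlb.
have lt_le (A : set T) : ~ cle (cardT T) (card A) -> clt (card A) (cardT T).
  move=> nA; have [//|AT] := cle_total (cardT T) (card A); split=> // AE.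
  by apply: nA; rewrite AE; exact: cle_refl.
(* If some segment is as large as [T], take the least point [a] with such a segment and pull [lt]
   back along an injection [h] of [T] into the segment of [a]: the new segments embed in segments of
   points below [a]. *)
have [[a0 ha0]|nbig] := pselect (exists a, cle (cardT T) (card [set x | lt x a])); last first.
  by exists lt; split=> // a; apply: lt_le => h; apply: nbig; exists a.
have [a Ta amin] := lt_min [set a | cle (cardT T) (card [set x | lt x a])]
  (ex_intro _ a0 ha0).
have [h [ha hI]] : exists h : T -> T, (forall x, lt (h x) a) /\ injective h.
  move: Ta => /=; rewrite -card_setT => /(card_le_funP a0)[h [ha hI]].
  by exists h; split=> [x|x y]; [exact: ha|exact: hI].
exists (fun x y => lt (h x) (h y)); split.
- by move=> x y z; exact: lt_trans.
- move=> x y; have [xy|/hI xy|xy] := lt_tot (h x) (h y).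
  + by constructor 1.
  + by constructor 2.
  + by constructor 3.
- move=> A [x Ax]; have [|_ [m Am <-] hm] := lt_min (h @` A).
    by exists (h x); exists x.
  by exists m => // y /hm hy Ay; apply: hy; exists y.
- move=> b; apply: lt_le => Tb; apply: (amin (h b)) => //=.
  apply: cle_trans Tb _; apply/cle_cardT.
  exists (fun x : [set x | lt (h x) (h b)] =>
    SigSub (mem_set (set_mem (valP x) : [set x | lt x (h b)] (h (val x))))).
  by move=> x y [] /hI /val_inj.
Qed.

Lemma cexp_cardT A B : cexp (cardT A) (cardT B) = cardT (B -> A).
Proof.
(* The map [s] built below is a left inverse of [d], with values taken from [r] off the range of
   [d]. Without [r], an empty [D] and [C'] beside a non-empty [D'] would be a counterexample. *)
have mono C C' D D' : cle (cardT C) (cardT C') -> cle (cardT D) (cardT D') ->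
    cle (cardT D') (cardT D) -> cle (cardT (D -> C)) (cardT (D' -> C')).
  move=> /cle_cardT[c cI] /cle_cardT[d dI] /cle_cardT[r _].
  have /choice[s sP] x : exists y, forall z, d z = x -> y = z.
    have [[z <-]|nx] := pselect (exists z, d z = x); first by exists z => t /dI.
    by exists (r x) => z dz; case: nx; exists z.
  apply/cle_cardT; exists (fun f => c \o f \o s) => f g fg.
  apply: funext => x; apply: cI.
  by have := congr1 (fun h => h (d x)) fg; rewrite /= (sP _ x).
rewrite /cexp; apply: cle_anti; apply: mono; rewrite creprK; exact: cle_refl.
Qed.

Lemma cexp2_cardT T : cexp (cnat 2) (cardT T) = cardT (T -> bool).
Proof.
have -> : cnat 2 = cardT bool; last exact: cexp_cardT.
apply: cle_anti; apply/cle_cardT.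
  exists (fun i : 'I_2 => i == ord0) => -[[|[|//]] i] [[|[|//]] j] //= _; exact: val_inj.
by exists (fun b : bool => if b then ord0 else ord_max) => -[] [].
Qed.

Lemma clt_cexp2 k : clt k (cexp (cnat 2) k).
Proof.
rewrite -(creprK k) cexp2_cardT; move: (crepr k) => T; split.
  apply/cle_cardT; exists (fun x y => `[< x = y >]) => x y.
  by move=> /(congr1 (fun f => f y)); rewrite (asboolT (erefl y)) => /asboolP.
move=> TE; have /cle_cardT[f fI] : cle (cardT (T -> bool)) (cardT T).
  by rewrite -TE; exact: cle_refl.
(* Cantor's diagonal set, read through an injection: [d x] says that some [g] with code [x] is false
   at [x]. Either value of [d (f d)] is absurd. *)
pose d x := `[< exists2 g, f g = x & ~~ g x >].
case dE: (d (f d)); first by have /asboolP[g /fI->] := dE; rewrite dE.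
suff : d (f d) by rewrite dE.
by apply/asboolP; exists d => //; rewrite dE.
Qed.

Lemma infinite_cardP T (A : set T) : infinite_set A <-> cle (cardT nat) (card A).
Proof. by rewrite infiniteP -cle_card card_setT. Qed.

Lemma infinite_cfinite T (A : set T) : ~ cfinite (card A) -> infinite_set A.
Proof.
move=> nA [n /card_eqPle[An nA']]; apply: nA; exists n; rewrite cnatE.
by apply: cle_anti; apply/cle_card.
Qed.

(** * Chains of subsets from the lexicographic order *)

Lemma pow2_set_chain K : (exists f : nat -> K, injective f) ->
  (forall n, clt n (cardT K) -> cle (cexp (cnat 2) n) (cardT K)) ->
  exists C : (K -> bool) -> set K, injective C /\
    forall f g, C f `<=` C g \/ C g `<=` C f.
Proof.
move=> /infinite_square[p pI] pow2K.
have [lt [lt_trans lt_tot lt_min lt_seg]] := initial_order K.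
(* [E a] codes in [K] the restriction of a sequence to the segment of [a]; this segment is smaller
   than [K] by [lt_seg], so [pow2K] applies. *)
have /choice[E EP] a : exists E : (K -> bool) -> K, forall s t, E s = E t ->
    forall x, lt x a -> s x = t x.
  have := pow2K _ (lt_seg a); rewrite /card cexp2_cardT => /cle_cardT[e eI].
  exists (fun s => e (s \o val)) => s t /eI st x xa.
  by have := congr1 (fun h => h (SigSub (mem_set (xa : [set y | lt y a] x)))) st.
(* The pair [(a, s)], with [s] read only below [a], stands for the sequence equal
   to [s] below [a], to [1] at [a] and to [0] above; [below f a s] says that it is
   lexicographically at most [f] restricted to the segment up to [a]. *)
pose below (f : K -> bool) a (s : K -> bool) := exists b,
  [/\ b = a \/ lt b a, forall x, lt x b -> s x = f x, f b & lt b a -> s b = false].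
pose C (f : K -> bool) := [set k | exists a s, k = p (a, E a s) /\ below f a s].
(* Membership does not depend on the [s] behind a code: sequences with equal codes agree below [a],
   and [below] reads [s] nowhere else. *)
have CP f a s : C f (p (a, E a s)) <-> below f a s.
  split=> [[c [t [/pI[ca]]]]|h]; last by exists a, s.
  subst c => /EP st [b [ba tf fb tb]]; exists b; split=> // [x xb|ba'].
    rewrite -tf// st//; case: ba => [<-//|]; exact: lt_trans.
  by rewrite st// tb.
(* At the first difference [m], the sequence equal to [f] below [m] with its last 1 at [m] is at
   most [g] but not at most [f]. For the inclusion, a witness [b] before [m] still serves for [g],
   and one after [m] is replaced by [m], where [s] agrees with [f] and so is 0. *)
have step f g m : (forall x, lt x m -> f x = g x) -> f m = false -> g m ->
    C f `<=` C g /\ ~ C g `<=` C f.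
  move=> fg fm gm; split=> [_ [a [s [-> [b [ba sf fb sb]]]]]|].
    apply/CP; have [bm|bm|mb] := lt_tot b m.
    - exists b; split=> // [x xb|]; last by rewrite -fg.
      by rewrite sf// fg//; exact: lt_trans xb bm.
    - by move: fb; rewrite bm fm.
    - exists m; split=> // [|x xm|_]; last by rewrite sf.
        by right; case: ba => [<-//|]; exact: lt_trans.
      by rewrite sf ?fg//; exact: lt_trans xm mb.
  have : C g (p (m, E m f)) by apply/CP; exists m; split=> //; left.
  move=> + gf => /gf /CP[b [[->|bm] _ fb fb']]; first by rewrite fm in fb.
  by rewrite fb' in fb.
have cmp f g : [\/ f = g, C f `<=` C g /\ ~ C g `<=` C f | C g `<=` C f /\ ~ C f `<=` C g].
  have [->|nfg] := pselect (f = g); first by constructor 1.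
  have [|m fgm mP] := lt_min [set x | f x <> g x].
    apply: contrapT => h; apply: nfg; apply: funext => x.
    by apply: contrapT => fgx; apply: h; exists x.
  have {}mP x : lt x m -> f x = g x by move=> /mP /contrapT.
  case fm: (f m) (fgm) => /=; case gm: (g m) => // _.
    by constructor 3; apply: (step _ _ m) => // x /mP.
  by constructor 2; apply: (step _ _ m).
exists C; split=> [f g fg|f g].
  by have [//||] := cmp f g; rewrite fg => -[].
by have [->|[]|[]] := cmp f g; [left|left|right].
Qed.

(** * Independent sets and bases *)

Section Subspaces.
Variable G : plgeometry.
Implicit Types (X Y Z B : set (pt G)).

Lemma sub_spn X : X `<=` spn X.
Proof. by move=> x Xx S [_ XS]; exact: XS. Qed.

Lemma spn_sub X S : subspace S -> X `<=` S -> spn X `<=` S.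
Proof. by move=> sS XS x; apply. Qed.

Lemma spn_mono X Y : X `<=` Y -> spn X `<=` spn Y.
Proof.
move=> XY; apply: spn_sub; first exact: spn_subspace.
by apply: subset_trans XY _; exact: sub_spn.
Qed.

Definition independent B := forall b, B b -> ~ spn (B `\ b) b.

(** A point of [Y] outside [Z] would lie in [spn Z], hence in the span of the rest of [B]. *)
Lemma independent_spn_inj B Y Z : independent B -> Y `<=` B -> Z `<=` B ->
  spn Y `<=` spn Z -> Y `<=` Z.
Proof.
move=> iB YB ZB YZ y Yy; apply: contrapT => nZy.
apply: (iB y (YB _ Yy)); apply: (@spn_mono Z); last by apply: YZ; exact: sub_spn.
by move=> z Zz; split; [exact: ZB|move=> /= zy; apply: nZy; rewrite -zy].
Qed.

(** The closure condition involves two points at a time, and in a chain these lie in a common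
    member. *)
Lemma bigcup_subspace (F : set (set (pt G))) : F `<=` @subspace G ->
  total_on F subset -> subspace (\bigcup_(S in F) S).
Proof.
move=> sF totF L GL [x [y [xy [Lx [S FS Sx]] [Ly [T FT Ty]]]]] z Lz.
have [ST|TS] := totF _ _ FS FT.
  by exists T => //; apply: (sF _ FT L) Lz => //; exists x, y; split=> //; split=> //; exact: ST.
by exists S => //; apply: (sF _ FS L) Lz => //; exists x, y; split=> //; split=> //; exact: TS.
Qed.

(** Zorn's lemma on the independent subsets of [X]. The basis is sought inside a given [X] so that a
    generating set of least size bounds its cardinality. *)
Lemma exists_basis (EP : exchange_property G) X :
  exists B, [/\ B `<=` X, independent B & X `<=` spn B].
Proof.
have [|B [[BX iB] maxB]] := @Zorn_bigcup _ (fun B => B `<=` X /\ independent B).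
  move=> F FP totF; split; first by move=> x [Y /FP[YX _]]; exact: YX.
  move=> b [Y FY Yb].
  (* If [b] depends on the rest of the union, it already depends on the rest of a single [Z]: the
     spans of the sets [Z] without [b] form a chain, so their union is a subspace. *)
  have totD : total_on [set spn (Z `\ b) | Z in F] subset.
    move=> _ _ [Z FZ <-] [W FW <-].
    by have [ZW|WZ] := totF _ _ FZ FW; [left|right]; apply: spn_mono; exact: setSD.
  have sD : [set spn (Z `\ b) | Z in F] `<=` @subspace G.
    by move=> _ [Z _ <-]; exact: spn_subspace.
  move=> /(spn_sub (bigcup_subspace sD totD))[].
    move=> x [[Z FZ Zx] xb]; exists (spn (Z `\ b)); first by exists Z.
    exact: sub_spn.
  move=> _ [Z FZ <-] Zb; have [ZY|YZ] := totF _ _ FZ FY.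
    by apply: ((FP _ FY).2 b Yb); apply: spn_mono Zb; exact: setSD.
  exact: (FP _ FZ).2 (YZ _ Yb) Zb.
exists B; split=> // x Xx; apply: contrapT => nBx.
apply: (maxB (B `|` [set x])).
  split; first by move=> y By; left.
  by move=> /(_ x (or_intror erefl)) /sub_spn.
split=> [y [/BX//|->//]|b [Bb|->]]; last first.
  by move=> h; apply: nBx; apply: spn_mono h => y [[//|->] []].
have [bx|nbx] := pselect (b = x); first by case: nBx; rewrite -bx; exact: sub_spn.
move=> Bxb; have {Bxb} : spn ((B `\ b) `|` [set x]) b.
  by apply: spn_mono Bxb => y [[By|->] yb]; [left|right].
(* Since [b] is outside the span of the rest of [B], exchange puts [x] in the span of [B]. *)
move=> /EP /(_ (iB _ Bb)) h; apply: nBx; apply: spn_mono h.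
by move=> y [[]//|->].
Qed.

End Subspaces.

(** * The chain of spans of subsets of a basis *)

Local Open Scope cardinal_scope.

Theorem theorem1p2 (G : plgeometry) (EP : exchange_property G) :
  ~ cfinite (rank EP) ->
  (forall n : cardinal, n < rank EP -> cnat 2 ^ n <= rank EP) ->
  cnat 2 ^ rank EP <= chain_rank G /\ rank EP < cnat 2 ^ rank EP.
Proof.
move=> infk pow2k; split; last exact: clt_cexp2.
have [[X gX rX] minX] := gen_rankP G.
have [B [BX iB XB]] := exists_basis EP X.
(* [B] generates, so its size is at least the rank; it lies in [X], whose size is the rank. *)
have kB : rank EP = card B.
  apply: cle_anti.
    apply: minX; apply/seteqP; split=> // x _.
    have : spn X x by rewrite gX.
    by apply: spn_sub => //; exact: spn_subspace.
  by rewrite /rank rX; apply/cle_card; exact: subset_card_le.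
rewrite kB in infk pow2k *.
have natB := (infinite_cardP B).1 (infinite_cfinite infk).
have [C [CI totC]] := pow2_set_chain ((cle_cardT _ _).1 natB) pow2k.
pose S f := spn [set val x | x in C f].
have SB f : [set val x | x in C f] `<=` B by move=> _ [x _ <-]; exact: set_mem (valP x).
have SI f g : S f `<=` S g -> C f `<=` C g.
  move=> /(independent_spn_inj iB (SB f) (SB g)) fg x Cx.
  by have [|y Cy /val_inj <-] := fg (val x); first by exists x.
have S_inj : injective S.
  by move=> f g fg; apply: CI; apply/seteqP; split; apply: SI; rewrite fg.
have chS : is_chain (range S).
  split; first by exists (S xpredT); exists xpredT.
    by move=> _ [f _ <-]; exact: spn_subspace.
  move=> _ _ [f _ <-] [g _ <-].
  by have [fg|gf] := totC f g; [left|right]; apply: spn_mono; exact: image_subset.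
have le_range : cardT (B -> bool) <= card (range S).
  apply/cle_cardT.
  exists (fun f => SigSub (mem_set (imageT S f))) => f g [].
  exact: S_inj.
(* Length equals cardinality only for infinite chains; [range S] is infinite because it has at least
   as many members as [B] has subsets. *)
have lenS : chain_length (range S) = card (range S).
  rewrite /chain_length; case: asboolP => // finS.
  have : infinite_set (range S); last by case.
  apply/infinite_cardP; apply: cle_trans le_range; apply: cle_trans natB _.
  by rewrite -cexp2_cardT; exact: (clt_cexp2 _).1.
rewrite cexp2_cardT; apply: cle_trans le_range _.
rewrite -lenS; exact: (chain_rankP G).1.
Qed.
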